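(* Let $n\ge5$ and let $M$ be a kernel-free MLS on $[n]$ with $f_2=n-1$, where $f_2=|\{S\in M:|S|=2\}|$. Then $M=\mathcal F_a^{*}$ for some $a\in[n]$. Consequently, if $M$ is a kernel-free MLS on $[n]$ with $M\ne\mathcal F_a^{*}$ for all $a\in[n]$, then $f_2\le n-2$.
   Context: $[n]=\{1,\dots,n\}$; $V_n$ is the set of nonempty subsets of $[n]$. A family $\mathcal F\subseteq V_n$ is intersecting if $A\cap B\ne\varnothing$ for all $A,B\in\mathcal F$. A maximal linked system (MLS) on $[n]$ is an inclusion-maximal intersecting family $\mathcal F\subseteq V_n$; it is kernel-free if $\bigcap_{S\in\mathcal F}S=\varnothing$. $\mathrm{Star}(a)=\{S\in V_n:a\in S\}$ and $\mathcal F_a^{*}=(\mathrm{Star}(a)\setminus\{\{a\}\})\cup\{[n]\setminus\{a\}\}$. *)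

(* Defs.v *)
(* The ground set [n] = {1, ..., n} is represented by the type 'I_n. *)
From mathcomp Require Import all_boot.

Set Implicit Arguments.
Unset Strict Implicit.
Unset Printing Implicit Defensive.

Definition V (n : nat) : {set {set 'I_n}} := [set S | S != set0].

(* A and B are not required to be distinct. *)
Definition intersecting (n : nat) (F : {set {set 'I_n}}) : bool :=
  (F \subset V n) && [forall A in F, forall B in F, A :&: B != set0].

Definition MLS (n : nat) (F : {set {set 'I_n}}) : bool :=
  maxset (@intersecting n) F.

Definition kernel_free (n : nat) (F : {set {set 'I_n}}) : bool :=
  \bigcap_(S in F) S == set0.

Definition Star (n : nat) (a : 'I_n) : {set {set 'I_n}} :=
  [set S in V n | a \in S].

Definition Fstar (n : nat) (a : 'I_n) : {set {set 'I_n}} :=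
  (Star a :\ [set a]) :|: [set [set~ a]].

Definition f2 (n : nat) (F : {set {set 'I_n}}) : nat :=
  #|[set S in F | #|S| == 2]|.

(* Main.v *)
Require Import Defs.
From mathcomp Require Import all_boot.

Set Implicit Arguments.
Unset Strict Implicit.
Unset Printing Implicit Defensive.

(** Four pairwise intersecting 2-sets have a common point, since three of them
    without one form a triangle, and no further 2-set meets all sides of a
    triangle. So [n - 1 >= 4] edges in [M] are all the edges at some [a]. A
    member of [M] avoiding [a] meets every [{a, x}], hence equals [[n] \ {a}];
    such a member exists because [M] is kernel-free. Thus [M] is contained in
    [F_a^*], which is intersecting, and maximality concludes. *)

Lemma setI2_neq0 (T : finType) (x y : T) (B : {set T}) :
  ([set x; y] :&: B != set0) = (x \in B) || (y \in B).
Proof.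
apply/set0Pn/orP => [[z] | [] h]; last 2 first.
- by exists x; rewrite !inE eqxx.
- by exists y; rewrite !inE eqxx orbT.
by rewrite !inE => /andP[/orP[]/eqP-> ->]; [left | right].
Qed.

Lemma eq_set2_card (T : finType) (x y : T) (A : {set T}) :
  #|A| = 2 -> x != y -> x \in A -> y \in A -> A = [set x; y].
Proof.
move=> cA xy xA yA; apply/eqP; rewrite eq_sym eqEcard cA cards2 xy andbT.
by apply/subsetP=> z; rewrite !inE => /orP[]/eqP->.
Qed.

Lemma intersecting_edges_common_point (T : finType) (E : {set {set T}}) :
  {in E, forall A : {set _}, #|A| = 2} ->
  {in E &, forall A B : {set T}, A :&: B != set0} ->
  3 < #|E| -> exists a, {in E, forall A : {set T}, a \in A}.
Proof.
move=> E2 EI cE.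
have /card_gt1P[A [B [AE BE AB]]] : 1 < #|E| by apply: leq_trans cE.
have /set0Pn[a] := EI _ _ AE BE; rewrite inE => /andP[aA aB].
have other (X : {set T}) : X \in E -> a \in X -> exists2 x, a != x & X = [set a; x].
  move=> XE aX; have /eqP/cards2P[u [v [uv eX]]] := E2 _ XE.
  move: aX; rewrite eX !inE => /orP[]/eqP->; first by exists v.
  by exists u; rewrite 1?eq_sym // setUC.
have [b ab eA] := other _ AE aA; have [c ac eB] := other _ BE aB.
have bc : b != c by apply: contraNneq AB => bc; rewrite eA eB bc.
(* If some [C] misses [a], then [A], [B], [C] form the triangle on [a], [b], [c], and it remains to
   bound [#|E|] by 3. *)
exists a => C CE; apply: contraLR cE => aC.
have meetA X : X \in E -> (a \in X) || (b \in X).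
  by move=> XE; rewrite -setI2_neq0 -eA EI.
have meetB X : X \in E -> (a \in X) || (c \in X).
  by move=> XE; rewrite -setI2_neq0 -eB EI.
have eC : C = [set b; c].
  move: (meetA _ CE) (meetB _ CE); rewrite (negPf aC) /=.
  exact: eq_set2_card (E2 _ CE) bc.
have meetC X : X \in E -> (b \in X) || (c \in X).
  by move=> XE; rewrite -setI2_neq0 -eC EI.
rewrite -leqNgt.
have sE : E \subset [set A; B; C].
  apply/subsetP=> X XE; rewrite !inE.
  move: (meetA _ XE) (meetB _ XE) (meetC _ XE).
  (* An edge through [a] meets [C] in [b] or [c], so it is [A] or [B]; an edge avoiding [a] needs
     [b] to meet [A] and [c] to meet [B]. *)
  have [aX _ _ | aX /= bX cX _] := boolP (a \in X).
    case/orP=> h; first by rewrite eA (eq_set2_card (E2 _ XE) ab aX h) eqxx.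
    by rewrite eB (eq_set2_card (E2 _ XE) ac aX h) eqxx orbT.
  by rewrite eC (eq_set2_card (E2 _ XE) bc bX cX) eqxx orbT.
apply: leq_trans (subset_leq_card sE) _.
by rewrite setUC cardsU1 cards2; case: (_ \notin _); case: (_ != _).
Qed.

(** Members of the star share [a], and those other than [[set a]] have a second point, which lies in
    [[set~ a]]. The bound on [n] makes [[set~ a]] nonempty. *)
Lemma Fstar_intersecting (n : nat) (a : 'I_n) : 1 < n -> intersecting (Fstar a).
Proof.
move=> n1.
have co0 : [set~ a] != set0.
  by rewrite -card_gt0 cardsC1 card_ord -ltnS prednK // ltnW.
have coI (A : {set _}) : a \in A -> A != [set a] -> A :&: [set~ a] != set0.
  move=> aA; rewrite -setDE; apply: contra; rewrite setD_eq0 subset1.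
  by case/orP=> // /eqP A0; rewrite A0 inE in aA.
apply/andP; split.
  by apply/subsetP=> A; rewrite !inE => /orP[/and3P[] | /eqP->].
apply/forall_inP=> A FA; apply/forall_inP=> B FB; move: FA FB.
rewrite !inE => /orP[/and3P[A1 _ aA] | /eqP->] /orP[/and3P[B1 _ aB] | /eqP->].
- by apply/set0Pn; exists a; rewrite inE aA.
- exact: coI.
- by rewrite setIC coI.
- by rewrite setIid.
Qed.

(** Assuming only a lower bound on [f2 M] serves both the equality case and the contrapositive of
    [f2 M <= n - 2]. *)
Lemma MLS_many_edges (n : nat) (M : {set {set 'I_n}}) :
  5 <= n -> MLS M -> kernel_free M -> n - 1 <= f2 M ->
  exists a : 'I_n, M = Fstar a.
Proof.
move=> n5 /maxsetP[/andP[MV /forall_inP MI] Mmax] kM fM.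
have {}MI : {in M &, forall A B : {set _}, A :&: B != set0}.
  by move=> A B AM BM; exact: (forall_inP (MI _ AM)).
pose E := [set S in M | #|S| == 2].
have EM : E \subset M by apply/subsetP=> A; rewrite inE => /andP[].
have E2 : {in E, forall A : {set _}, #|A| = 2} by move=> A; rewrite inE => /andP[_ /eqP].
(* Here [5 <= n] enters: it gives [3 < n - 1]. *)
have [|a aE] := intersecting_edges_common_point E2 (sub_in2 (subsetP EM) MI).
  by apply: leq_trans fM; rewrite ltn_subRL.
exists a.
have sE : E \subset [set [set a; x] | x in [set~ a]].
  apply/subsetP=> A AE; have /eqP/cards2P[u [v [uv eA]]] := E2 _ AE.
  have := aE _ AE; rewrite eA !inE => /orP[]/eqP->.
    by apply/imsetP; exists v; rewrite // !inE eq_sym.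
  by apply/imsetP; exists u; rewrite ?inE // setUC.
(* Only [n - 1] pairs contain [a], so [E] exhausts them. *)
have eE : E = [set [set a; x] | x in [set~ a]].
  apply/eqP; rewrite eqEcard sE (leq_trans (leq_imset_card _ _)) //.
  by rewrite cardsC1 card_ord -subn1.
have edgeM x : x != a -> [set a; x] \in M.
  by move=> xa; apply: (subsetP EM); rewrite eE; apply: imset_f; rewrite !inE.
have avoid (S : {set 'I_n}) : S \in M -> a \notin S -> S = [set~ a].
  move=> SM aS; apply/setP=> x; rewrite !inE.
  have [-> | xa] := eqVneq x a; first exact: negPf.
  by have := MI _ _ (edgeM _ xa) SM; rewrite setI2_neq0 (negPf aS).
(* Otherwise, by [avoid], every member of [M] would contain [a], putting [a] in the kernel. *)
have coM : [set~ a] \in M.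
  have : a \notin \bigcap_(S in M) S by rewrite (eqP kM) inE.
  apply: contraNT => coM; apply/bigcapP=> S SM.
  by apply: contraNT coM => aS; rewrite -(avoid _ SM aS).
apply/esym/Mmax; first by rewrite Fstar_intersecting // (leq_trans _ n5).
apply/subsetP=> S SM; rewrite !inE.
have [aS | aS] := boolP (a \in S); last by rewrite (avoid _ SM aS) eqxx orbT.
have := subsetP MV _ SM; rewrite inE => -> /=; rewrite andbT.
(* [S] is not [[set a]], which is disjoint from the member [[set~ a]]. *)
by apply/orP; left; apply: contraTneq (MI _ _ SM coM) => ->; rewrite setICr eqxx.
Qed.

Theorem lemma5p3 (n : nat) (hn : 5 <= n) :
  (forall M : {set {set 'I_n}},
      MLS M -> kernel_free M -> f2 M = n - 1 ->
      exists a : 'I_n, M = Fstar a) /\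
  (forall M : {set {set 'I_n}},
      MLS M -> kernel_free M -> (forall a : 'I_n, M <> Fstar a) ->
      f2 M <= n - 2).
Proof.
split=> M mM kM => [fM | neF]; first by apply: MLS_many_edges; rewrite ?fM.
rewrite leqNgt; apply/negP=> lt.
have [|a /neF //] := MLS_many_edges hn mM kM.
(* Truncated subtraction is harmless: [2 <= n] gives [(n - 2).+1 = n - 1]. *)
by apply: leq_trans lt; rewrite -subSn ?subSS // (leq_trans _ hn).
Qed.
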